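(* For every integer $n\ge 0$, $$\det\left[\binom{2(i+j)+3}{i+j}\right]_{0\le i,j\le n}=\begin{cases}\frac13(2n+3)&\text{if } n\equiv 0\pmod 3,\\[2pt]-\frac43(n+2)&\text{if } n\equiv 1\pmod 3,\\[2pt]\frac13(2n+5)&\text{if } n\equiv 2\pmod 3.\end{cases}$$
   Context: The determinant is that of the $(n+1)\times(n+1)$ matrix whose $(i,j)$ entry, $0\le i,j\le n$, is the binomial coefficient $\binom{2(i+j)+3}{i+j}$. *)

(* Defs.v *)
From mathcomp Require Export all_boot all_order all_algebra.
Export GRing.Theory Num.Theory.

Set Implicit Arguments.
Unset Strict Implicit.
Unset Printing Implicit Defensive.

(* Main.v *)
Require Import Defs.
From mathcomp Require Import all_boot all_order all_algebra.
From mathcomp Require Import zify ring lra.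
Local Open Scope ring_scope.

(** Write [x = u + 2 + u^-1]. The number [C(2k+3, k)] is the constant term of
    [x^k (1 + u)^3], and expanding the powers of [x] in the monic polynomials
    [p_l = (u^(l+1/2) + u^(-l-1/2)) / (u^(1/2) + u^(-1/2))] gives
    [x^i = sum_l C(2i+1, i+l+1) p_l]. In the basis [p_l] the Hankel form becomes
    multiplication by [u^2 + u + u^-1 + u^-2 = x^2 - 3x], a pentadiagonal matrix
    whose factorization [L D L^T] has entries that are explicit modulo 3; the
    determinant is the product of the entries of [D]. *)

Definition xpow_coef (i l : nat) : rat := 'C((2 * i).+1, (i + l).+1)%:R.

(* Multiplication by [x] in the basis [p_l]; the boundary coefficient 3 comes
   from [p_(-1) = p_0]. *)
Definition mulx (f : nat -> rat) (l : nat) : rat :=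
  if l is k.+1 then f k + 2 * f k.+1 + f k.+2 else 3 * f 0 + f 1.

(** Pascal's rule applied twice; at [l = 0] the symmetry [sym] folds the term of index -1 onto index
    0. *)
Lemma xpow_coefS i : xpow_coef i.+1 =1 mulx (xpow_coef i).
Proof.
have sym : 'C((2 * i).+1, i) = 'C((2 * i).+1, i.+1).
  by rewrite -bin_sub; [congr 'C(_, _); lia | lia].
rewrite /xpow_coef mulnS add2n; move: (2 * i).+1 sym => N sym [|l] /=.
  by rewrite !addSn !addnS !addn0 !binS sym !natrD; ring.
by rewrite !addSn !addnS !binS !natrD; ring.
Qed.

Lemma xpow_coef_small i l : (i < l)%N -> xpow_coef i l = 0.
Proof. by move=> lt_il; rewrite /xpow_coef bin_small //; lia. Qed.

(** Discrete Green identity: [mulx] is symmetric, so a truncated sum leaves only a boundary term at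
    [N]. *)
Lemma mulx_green (f g : nat -> rat) N :
  \sum_(l < N.+1) (mulx f l * g l - f l * mulx g l) =
  f N.+1 * g N - f N * g N.+1.
Proof.
elim: N => [|N IHN]; first by rewrite big_ord1 /=; ring.
by rewrite big_ord_recr IHN /=; ring.
Qed.

Lemma sum_xpow_coef N i j : (j < N)%N ->
  \sum_(l < N) xpow_coef i l * xpow_coef j l =
  'C((2 * (i + j)).+1, (i + j).+1)%:R.
Proof.
case: N => // N; elim: j i => [|j IHj] i lt_jN.
  rewrite big_ord_recl big1 => [|l _].
    by rewrite /xpow_coef addr0 /= mulr1 !addn0.
  by rewrite (@xpow_coef_small 0) ?mulr0.
(* One factor [x] moves from the right power to the left. The boundary term vanishes because the row
   of [j] is zero from [N] on; [i] may be arbitrarily large. *)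
rewrite addnS -addSn -IHj 1?ltnW //; apply/eqP; rewrite eq_sym -subr_eq0 -sumrB.
rewrite (eq_bigr (fun l : 'I_N.+1 =>
  mulx (xpow_coef i) l * xpow_coef j l - xpow_coef i l * mulx (xpow_coef j) l)).
  by rewrite mulx_green !(@xpow_coef_small j) ?mulr0 ?subr0 // ltnW.
by move=> l _; rewrite !xpow_coefS.
Qed.

(** The target entry is the coefficient of [p_0] in [(x^2 - 3x) x^N]. *)
Lemma bin_mulx_identity N :
  'C(2 * N + 3, N)%:R =
  'C((2 * N.+2).+1, N.+3)%:R - 3 * 'C((2 * N.+1).+1, N.+2)%:R :> rat.
Proof.
have -> : ((2 * N.+2).+1 = (2 * N + 3).+2)%N by lia.
have -> : ((2 * N.+1).+1 = 2 * N + 3)%N by lia.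
have sym a b : (a + b = 2 * N + 3)%N -> 'C(2 * N + 3, a) = 'C(2 * N + 3, b).
  by move=> ab; rewrite -bin_sub; [congr 'C(_, _); lia | lia].
by rewrite !binS !natrD (sym N.+3 N) ?(sym N.+1 N.+2); try lia; ring.
Qed.

Definition pivot (k : nat) : rat :=
  let m := (k %/ 3)%:R in
  match (k %% 3)%N with
  | 0 => 1
  | 1 => - (4 * (m + 1)) / (2 * m + 1)
  | _ => - (2 * m + 3) / (4 * (m + 1))
  end.

Definition subdiag (k : nat) : rat :=
  let m := (k %/ 3)%:R in
  match (k %% 3)%N with
  | 0 => 2
  | 1 => (2 * m + 1) / (4 * (m + 1))
  | _ => -1
  end.

(** The outermost diagonals of the pentadiagonal matrix are 1, which forces the entry [1 / pivot l]
    two places below the diagonal. *)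
Definition Lfactor (k l : nat) : rat :=
  (k == l)%:R + (k == l.+1)%:R * subdiag l + (k == l.+2)%:R / pivot l.

Lemma mod3_ind (P : nat -> Prop) :
  (forall q, P (q * 3)) -> (forall q, P (q * 3).+1) ->
  (forall q, P (q * 3).+2) -> forall k, P k.
Proof.
move=> P0 P1 P2 k; rewrite (divn_eq k 3).
have := ltn_pmod k (isT : (0 < 3)%N).
by case: (k %% 3)%N => [|[|[|]]] // _; rewrite ?addn0 ?addn1 ?addn2.
Qed.

Lemma divmod3 q :
  [/\ (q * 3 %/ 3 = q)%N, ((q * 3).+1 %/ 3 = q)%N & ((q * 3).+2 %/ 3 = q)%N] /\
  [/\ (q * 3 %% 3 = 0)%N, ((q * 3).+1 %% 3 = 1)%N & ((q * 3).+2 %% 3 = 2)%N].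
Proof. by split; split; lia. Qed.

Lemma pivotE q :
  [/\ pivot (q * 3) = 1,
      pivot (q * 3).+1 = - (4 * (q%:R + 1)) / (2 * q%:R + 1)
    & pivot (q * 3).+2 = - (2 * q%:R + 3) / (4 * (q%:R + 1))].
Proof.
by rewrite /pivot; case: (divmod3 q) => -[-> -> ->] [-> -> ->].
Qed.

Lemma subdiagE q :
  [/\ subdiag (q * 3) = 2,
      subdiag (q * 3).+1 = (2 * q%:R + 1) / (4 * (q%:R + 1))
    & subdiag (q * 3).+2 = -1].
Proof.
by rewrite /subdiag; case: (divmod3 q) => -[-> -> ->] [-> -> ->].
Qed.

Lemma pivot_neq0 k : pivot k != 0.
Proof.
elim/mod3_ind: k => q; have [p0 p1 p2] := pivotE q; have q_ge0 := ler0n rat q;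
  rewrite ?p0 ?p1 ?p2 ?oner_eq0 // mulf_neq0 ?invr_eq0 ?oppr_eq0 //; lra.
Qed.

(** Entry [(k+2, k+1)] of [L D L^T], where multiplication by [x^2 - 3x] has 1. *)
Lemma subdiag_rec k : subdiag k.+1 * pivot k.+1 + subdiag k = 1.
Proof.
elim/mod3_ind: k => q; have q_ge0 := ler0n rat q;
  have [p0 p1 p2] := pivotE q; have [s0 s1 s2] := subdiagE q.
- by rewrite s0 s1 p1; field; rewrite ?(lt0r_neq0, andbT) //; lra.
- by rewrite s1 s2 p2; field; lra.
have [p0' _ _] := pivotE q.+1; have [s0' _ _] := subdiagE q.+1.
by rewrite -[(q * 3).+3]/(q.+1 * 3)%N s0' s2 p0'; ring.
Qed.

(** Diagonal entry [k+2] of [L D L^T]: it is 0, since [x^2 - 3x] has no constant term in [u]. *)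
Lemma pivot_rec k :
  pivot k.+2 + subdiag k.+1 ^+ 2 * pivot k.+1 + (pivot k)^-1 = 0.
Proof.
elim/mod3_ind: k => q; have q_ge0 := ler0n rat q;
  have [p0 p1 p2] := pivotE q; have [s0 s1 s2] := subdiagE q;
  have [p0' p1' _] := pivotE q.+1; have [s0' _ _] := subdiagE q.+1.
- by rewrite s1 p0 p1 p2; field; lra.
- by rewrite -[(q * 3).+3]/(q.+1 * 3)%N s2 p0' p1 p2; field; lra.
rewrite -[(q * 3).+4]/(q.+1 * 3).+1 -[(q * 3).+3]/(q.+1 * 3)%N.
by rewrite s0' p0' p1' p2 -natr1; field; lra.
Qed.

Lemma sum_delta (N k : nat) (f : nat -> rat) :
  \sum_(i < N) f i * (i == k :> nat)%:R = if (k < N)%N then f k else 0.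
Proof.
case: ltnP => [lt_kN | le_Nk].
  rewrite (bigD1 (Ordinal lt_kN)) //= eqxx mulr1 big1 ?addr0 // => i.
  by rewrite -val_eqE /= => /negbTE ->; rewrite mulr0.
rewrite big1 // => i _.
by rewrite ltn_eqF ?mulr0 // (leq_trans (ltn_ord i)).
Qed.

(** Column [l] reaches down to rows [l+1] and [l+2]; the support of [f] makes cutting them off at
    [N] harmless. *)
Lemma sum_Lfactor_col N (f : nat -> rat) l : (forall k, (N <= k)%N -> f k = 0) ->
  \sum_(k < N) f k * Lfactor k l =
  f l + subdiag l * f l.+1 + (pivot l)^-1 * f l.+2.
Proof.
move=> f0; have delta k : \sum_(i < N) f i * (i == k :> nat)%:R = f k.
  by rewrite sum_delta; case: ltnP => // /f0 ->.
rewrite -!delta !mulr_sumr -!big_split /=; apply: eq_bigr => k _.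
by rewrite /Lfactor; ring.
Qed.

Lemma sum_Lfactor_row N (g : nat -> rat) k : (k < N)%N ->
  \sum_(l < N) g l * Lfactor k l =
  g k + (if k is l.+1 then g l * subdiag l else 0)
      + (if k is l.+2 then g l / pivot l else 0).
Proof.
move=> lt_kN.
have -> : \sum_(l < N) g l * Lfactor k l =
    \sum_(l < N) g l * (l == k :> nat)%:R
  + \sum_(l < N) (g l * subdiag l) * (l.+1 == k :> nat)%:R
  + \sum_(l < N) (g l / pivot l) * (l.+2 == k :> nat)%:R.
  rewrite -!big_split; apply: eq_bigr => l _ /=.
  by rewrite /Lfactor !(eq_sym k); ring.
rewrite sum_delta lt_kN; congr (_ + _ + _); case: k lt_kN => [|k] lt_kN.
- by rewrite big1 // => l _; rewrite mulr0.
- under eq_bigr => l _ do rewrite eqSS.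
  by rewrite (sum_delta N k (fun l => g l * subdiag l)) ltnW.
- by rewrite big1 // => l _; rewrite mulr0.
case: k lt_kN => [|k] lt_kN; first by rewrite big1 // => l _; rewrite mulr0.
under eq_bigr => l _ do rewrite !eqSS.
by rewrite (sum_delta N k (fun l => g l / pivot l)) 2?ltnW.
Qed.

Lemma Lfactor_pivot_mulx N (f : nat -> rat) l :
  (forall k, (N <= k)%N -> f k = 0) -> (l < N)%N ->
  \sum_(m < N) (\sum_(k < N) f k * Lfactor k m) * pivot m * Lfactor l m =
  mulx (mulx f) l - 3 * mulx f l.
Proof.
move=> f0 lt_lN.
under eq_bigr => m _ do rewrite sum_Lfactor_col //.
rewrite (sum_Lfactor_row _ (fun m =>
  (f m + subdiag m * f m.+1 + (pivot m)^-1 * f m.+2) * pivot m)) //.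
have p0 : pivot 0 = 1 by [].
have p1 : pivot 1 = -4 by [].
have s0 : subdiag 0 = 2 by [].
(* Rows 0 and 1 feel the boundary coefficient 3 and are checked numerically. *)
case: l lt_lN => [|[|l]] _ /=.
- by rewrite p0 s0; field.
- have -> : subdiag 1 = 4^-1 by [].
  by rewrite p0 p1 s0; field.
have sr0 := subdiag_rec l; have sr1 := subdiag_rec l.+1.
have pr := pivot_rec l.
have := pivot_neq0 l; have := pivot_neq0 l.+1; have := pivot_neq0 l.+2.
move=> nz2 nz1 nz0; apply/eqP; rewrite -subr_eq0; apply/eqP.
(* The terms in [f l] and [f l.+4] cancel; each remaining coefficient is the defect of one
   recurrence. *)
transitivity (
    (subdiag l.+2 * pivot l.+2 + subdiag l.+1 - 1) * f l.+3
  + (pivot l.+2 + subdiag l.+1 ^+ 2 * pivot l.+1 + (pivot l)^-1) * f l.+2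
  + (subdiag l.+1 * pivot l.+1 + subdiag l - 1) * f l.+1).
  by field; rewrite nz0 nz1 nz2.
by rewrite sr0 sr1 pr; ring.
Qed.

(** The product telescopes: the pivots at [3q+1] and [3q+2] multiply to [(2q+3)/(2q+1)], and the one
    at [3q+3] is 1. *)
Lemma prod_pivot q :
  [/\ \prod_(i < (q * 3).+1) pivot i = 2 * q%:R + 1,
      \prod_(i < (q * 3).+2) pivot i = - (4 * (q%:R + 1))
    & \prod_(i < (q * 3).+3) pivot i = 2 * q%:R + 3].
Proof.
have step r : \prod_(i < (r * 3).+1) pivot i = 2 * r%:R + 1 ->
  \prod_(i < (r * 3).+2) pivot i = - (4 * (r%:R + 1)) /\
  \prod_(i < (r * 3).+3) pivot i = 2 * r%:R + 3.
  move=> Pr; have r_ge0 := ler0n rat r; have [_ p1 p2] := pivotE r.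
  by rewrite !big_ord_recr /= in Pr *; rewrite Pr p1 p2; split; field; lra.
suff P0 : \prod_(i < (q * 3).+1) pivot i = 2 * q%:R + 1.
  by have [P1 P2] := step q P0.
elim: q => [|q IHq]; first by rewrite big_ord1.
have [_ P2] := step q IHq; have [p0 _ _] := pivotE q.+1.
by rewrite big_ord_recr /= p0 -[(q.+1 * 3)%N]/(q * 3).+3 P2 -natr1; ring.
Qed.

Theorem corollary3 (n : nat) :
  \det (\matrix_(i < n.+1, j < n.+1)
          ('C((2 * (i + j) + 3)%N, (i + j)%N)%:R : rat)) =
  if (n == 0 %[mod 3])%N then 3%:R^-1 * (2 * n + 3)%N%:R
  else if (n == 1 %[mod 3])%N then - (4%:R / 3%:R) * (n + 2)%N%:R
  else 3%:R^-1 * (2 * n + 5)%N%:R.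
Proof.
pose T : 'M[rat]_n.+1 := \matrix_(i, j) xpow_coef i j.
pose L : 'M[rat]_n.+1 := \matrix_(i, j) Lfactor i j.
pose D : 'M[rat]_n.+1 := diag_mx (\row_j pivot j).
have -> : (\matrix_(i < n.+1, j < n.+1)
    ('C((2 * (i + j) + 3)%N, (i + j)%N)%:R : rat)) = T *m L *m D *m L^T *m T^T.
  apply/matrixP => i j; rewrite !mxE.
  under eq_bigr => l _.
    have -> : (T *m L *m D *m L^T) i l = xpow_coef i.+2 l - 3 * xpow_coef i.+1 l.
      have fS : mulx (xpow_coef i) =1 xpow_coef i.+1 by move=> ?; rewrite xpow_coefS.
      rewrite -fS xpow_coefS.
      have -> : mulx (xpow_coef i.+1) l = mulx (mulx (xpow_coef i)) l.
        by rewrite /mulx; case: (l : nat) => [|k]; rewrite !xpow_coefS.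
      rewrite -(@Lfactor_pivot_mulx n.+1) //; last first.
        by move=> k /(leq_trans (ltn_ord i)); exact: xpow_coef_small.
      rewrite mxE; apply: eq_bigr => m _.
      rewrite mul_mx_diag !mxE; congr (_ * _ * _).
      by apply: eq_bigr => k _; rewrite !mxE.
    rewrite !mxE mulrBl -mulrA; over.
  (* Pairing with [x^j] is exact as [j < n+1], even when [i+2] exceeds the matrix size. *)
  rewrite sumrB -mulr_sumr !sum_xpow_coef // bin_mulx_identity.
  by rewrite !addSn.
have detT : \det T = 1.
  rewrite det_trig; last first.
    by apply/is_trig_mxP => i j lt_ij; rewrite mxE xpow_coef_small.
  apply: big1 => i _; rewrite mxE /xpow_coef.
  by rewrite mul2n -addnn binn.
have detL : \det L = 1.
  rewrite det_trig; last first.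
    apply/is_trig_mxP => i j lt_ij; rewrite mxE /Lfactor.
    by rewrite !ltn_eqF ?mul0r ?addr0 // ltnW // ltnW.
  by apply: big1 => i _; rewrite mxE /Lfactor eqxx !ltn_eqF // !mul0r !addr0.
rewrite !det_mulmx !det_tr detT detL det_diag !mul1r !mulr1.
under eq_bigr => i _ do rewrite mxE.
(* Only the product of pivots remains; [n] is [3q], [3q+1] or [3q+2]. *)
elim/mod3_ind: n {T L D detT detL} => q; have [P0 P1 P2] := prod_pivot q;
  have [_ [r0 r1 r2]] := divmod3 q.
- by rewrite r0 P0 /= natrD !natrM; field.
- by rewrite r1 P1 /= -[(q * 3).+1]addn1 !natrD !natrM; field.
- by rewrite r2 P2 /= -[(q * 3).+2]addn2 !natrD !natrM; field.
Qed.
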